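(* Let $d$ be a positive integer and let $G=\mathbb{N}^d$ or $G=\mathbb{Z}^d$. Let $A$ be a finite nonempty set of symbols, and let $X\subseteq A^G$ be a subshift. Then $\mathrm{ent}(X)=\dim(X)$, where $\mathrm{ent}(X)$ is the topological entropy of $X$ under the shift action and $\dim(X)$ is the Hausdorff dimension of $X$ with respect to the standard metric on $A^G$.
   Context: $G$ is the additive monoid $\mathbb{N}^d$ or the additive group $\mathbb{Z}^d$. Put $F_n=\{0,1,\ldots,n\}^d$ if $G=\mathbb{N}^d$ and $F_n=\{-n,\ldots,-1,0,1,\ldots,n\}^d$ if $G=\mathbb{Z}^d$ (for $n\ge 0$), and $F_{-1}=\emptyset$. $A$ carries the discrete topology and $A^G=\{x\mid x:G\to A\}$ the product topology. The shift action is $S^g(x)(h)=x(g+h)$ for $g,h\in G$, $x\in A^G$. A subshift is a nonempty closed set $X\subseteq A^G$ with $S^g(x)\in X$ for all $g\in G$, $x\in X$. Topological entropy: for an open cover $\mathcal{U}$ of $X$ let $C(X,\mathcal{U})$ be the least cardinality of a subcover; for a finite $F\subset G$ let $\mathcal{U}^F$ be the open cover of $X$ consisting of all sets $\bigcap_{g\in F}(S^g)^{-1}(U_g)\cap X$ with $U_g\in\mathcal{U}$. Then $\mathrm{ent}(X,\mathcal{U})=\lim_{n\to\infty}\log_2 C(X,\mathcal{U}^{F_n})/|F_n|$ (this limit exists) and $\mathrm{ent}(X)=\sup_{\mathcal{U}}\mathrm{ent}(X,\mathcal{U})$ over all open covers $\mathcal{U}$ of $X$. (Equivalently, $\mathrm{ent}(X)=\lim_{n\to\infty}\log_2|X{\upharpoonright}F_n|/|F_n|$,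 where $X{\upharpoonright}F_n=\{x{\upharpoonright}F_n\mid x\in X\}$.) The standard metric on $A^G$ is $\rho(x,y)=2^{-|F_n|}$ where $n\in\{-1,0,1,2,\ldots\}$ is as large as possible such that $x{\upharpoonright}F_n=y{\upharpoonright}F_n$. Hausdorff dimension is taken with respect to $\rho$: $\mu_s(X)=\lim_{\epsilon\to0}\inf_{\mathcal{E}}\sum_{E\in\mathcal{E}}\mathrm{diam}(E)^s$ over covers $\mathcal{E}$ of $X$ by sets of diameter $\le\epsilon$, and $\dim(X)=\inf\{s\mid\mu_s(X)=0\}$. *)

(* Defs.v *)
From mathcomp Require Import all_boot all_order all_algebra.
From mathcomp Require Import finmap.
From mathcomp Require Import all_classical all_reals all_analysis.

Set Implicit Arguments.
Unset Strict Implicit.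
Unset Printing Implicit Defensive.

Import Order.TTheory GRing.Theory Num.Theory.
Import numFieldNormedType.Exports.
Local Open Scope classical_set_scope.
Local Open Scope ring_scope.

Notation natlat d := {ffun 'I_d -> nat}.
Notation intlat d := {ffun 'I_d -> int}.

Definition natbox (d n : nat) : set (natlat d) :=
  [set g : natlat d | forall i, (g i <= n)%N].

Definition intbox (d n : nat) : set (intlat d) :=
  [set g : intlat d | forall i, - n%:Z <= g i <= n%:Z].

Notation fullshift G A := (prod_topology (fun _ : G => discrete_topology A)).

(* The least natural number satisfying [P], and the greatest one.  Both default
   to 0 when there is none. *)
Definition least (P : set nat) : nat :=
  xget 0%N [set n | P n /\ forall m, P m -> (n <= m)%N].

Definition greatest (P : set nat) : nat :=
  xget 0%N [set n | P n /\ forall m, P m -> (m <= n)%N].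

Section Subshifts.
Variables (R : realType) (G : nmodType) (A : finType) (F : nat -> set G).
Implicit Types (X V W : set (fullshift G A))
  (U C : set (set (fullshift G A))).

Definition shift_act (g : G) (x : fullshift G A) : fullshift G A :=
  fun h => x (g + h).

Definition subshift X :=
  [/\ X !=set0, closed X & forall g x, X x -> X (shift_act g x)].

Definition window_card (n : nat) : nat := #|` fset_set (F n)|.

(* The members of a cover are open sets of the space [X] itself, i.e. relatively
   open subsets. *)
Definition open_cover X U :=
  (forall V, U V -> exists2 W, open W & V = W `&` X) /\
  X `<=` \bigcup_(V in U) V.

(* All open covers of a subshift have finite subcovers, [X] being compact. *)
Definition cover_number X U : nat :=
  least [set n | exists V : set (set (fullshift G A)),
    [/\ V `<=` U, X `<=` \bigcup_(W in V) W & (V #= `I_n)%card]].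

Definition cover_refine X U (E : set G) : set (set (fullshift G A)) :=
  [set V | exists2 u : G -> set (fullshift G A),
     (forall g, E g -> U (u g)) &
     V = (\bigcap_(g in E) (shift_act g @^-1` u g)) `&` X].

Definition log2 (x : R) : R := ln x / ln 2.

Definition cover_entropy X U : \bar R :=
  limn (fun n => (log2 (cover_number X (cover_refine X U (F n)))%:R /
                  (window_card n)%:R)%:E).

Definition entropy X : \bar R :=
  ereal_sup [set cover_entropy X U | U in open_cover X].

(* Windows shifted by one index: [window k] is F_(k-1), with F_(-1) empty. *)
Definition window (k : nat) : set G := if k is n.+1 then F n else set0.

Definition agree (x y : fullshift G A) (k : nat) :=
  forall g, window k g -> x g = y g.

(* If [x = y] there is no largest window of agreement; the distance is 0. *)
Definition rho (x y : fullshift G A) : R :=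
  if `[< x = y >] then 0
  else 2 ^- #|` fset_set (window (greatest (agree x y)))|.

Definition diam (E : set (fullshift G A)) : R :=
  sup [set rho p.1 p.2 | p in E `*` E].

(* Covers are countable, as usual for Hausdorff measure: with arbitrary covers
   the covering by singletons would make the infimum 0 for every [s > 0]. *)
Definition eps_cover (e : R) X C :=
  [/\ countable C, X `<=` \bigcup_(E in C) E & forall E, C E -> diam E <= e].

Definition hausdorff_content (s e : R) X : \bar R :=
  ereal_inf [set \esum_(E in C) (diam E `^ s)%:E | C in eps_cover e X].

Definition hausdorff_measure (s : R) X : \bar R :=
  lim (hausdorff_content s e X @[e --> 0^'+]).

Definition hausdorff_dim X : \bar R :=
  ereal_inf [set s%:E | s in [set s : R | 0 <= s /\ hausdorff_measure s X = 0%E]].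

End Subshifts.

Arguments entropy R {G A} F X.
Arguments hausdorff_dim R {G A} F X.

(* Main.v *)
(* Write p n for the number of patterns of X on F_n.  Covering X by the cylinders
   over F_n shows that dim X <= liminf (log2 (p n) / |F_n|).

   Conversely suppose that the s-dimensional measure of X vanishes.  By compactness X
   has, at every scale, a finite cover by cylinders of arbitrarily small total weight
   sum_i 2^(-s |F_(n_i)|).  Since X is shift invariant, around every point of F_N a
   given x in X looks like one of these cylinders.  Vitali's greedy argument packs
   disjoint such boxes covering at least the fraction 2^-d of F_N; repeating it with
   smaller and smaller scales inside what is left over (the boundary layers of
   the boxes already chosen being negligible) covers all but a fraction u of F_N.
   So x restricted to F_N is encoded by a labelling of F_N which marks the centres of
   the boxes with their cylinders and the uncovered points with their letters.  Giving
   a cylinder the weight 2^(-s |F_n|), a letter a small weight t and an unmarked point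
   the weight 1, each such labelling has product weight at least
   2^(-s |F_N|) t^(u |F_N|), whereas all labellings together have weight
   (1 + small)^|F_N|.  Hence limsup (log2 (p N) / |F_N|) <= s.

   So log2 (p n) / |F_n| converges to dim X.  It is the sequence defining the entropy
   of the cover according to the letter at the origin, and a Lebesgue number argument
   bounds the entropy of any other open cover by the same limit. *)
Require Import Defs.
From mathcomp Require Import all_boot all_order all_algebra.
From HB Require Import structures.
From mathcomp Require Import finmap zify ring lra.
From mathcomp Require Import all_classical all_reals all_analysis.

Set Implicit Arguments.
Unset Strict Implicit.
Unset Printing Implicit Defensive.

Import Order.TTheory GRing.Theory Num.Theory.
Import numFieldNormedType.Exports.
Local Open Scope classical_set_scope.
Local Open Scope ring_scope.

(** The properties of the boxes that the argument relies on, so that one proof serves both N^d and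
    Z^d. The rate [e] is 1 for N^d and 2 for Z^d. *)
Record box_system (G : nmodType) (F : nat -> set G) (e d : nat) : Prop :=
  BoxSystem {
  box_rate_gt0 : (0 < e)%N;
  box_dim_gt0 : (0 < d)%N;
  box_finite : forall n, finite_set (F n);
  box_card : forall n, #|` fset_set (F n)| = ((e * n).+1 ^ d)%N;
  box_zero : forall n, F n 0;
  box_homo : forall m n, (m <= n)%N -> F m `<=` F n;
  box_exhaust : forall g, exists n, F n g;
  box_add : forall m n f g, F m f -> F n g -> F (m + n)%N (f + g);
  box_cancel : forall g : G, injective (+%R g);
  (* few translates of [F m] meet a given translate of [F n] *)
  box_meet : forall m n (q : G), exists2 B : {fset G},
    (#|` B| <= #|` fset_set (F (n + m))|)%N &
    forall p f f', F m f -> F n f' -> p + f = q + f' -> p \in B }.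

(** * Disjoint unions and greedy packing of boxes *)

Lemma card_bigfcup_disjoint (I T : choiceType) (B : I -> {fset T}) (s : seq I) :
  uniq s -> (forall i j g, i \in s -> j \in s -> g \in B i -> g \in B j -> i = j) ->
  #|` \bigcup_(i <- s) B i|%fset = (\sum_(i <- s) #|` B i|)%N.
Proof.
elim: s => [|i s IH] /=; first by rewrite !big_nil cardfs0.
move=> /andP[si us] dis; rewrite !big_cons cardfsU IH //; last first.
  by move=> j k g js ks; apply: dis; rewrite inE ?js ?ks orbT.
suff -> : (B i `&` \bigcup_(j <- s) B j)%fset = fset0 by rewrite cardfs0 subn0.
apply/fsetP => g; rewrite !inE; apply/negP => /andP[gi /bigfcupP[j /andP[js _] gj]].
have e : i = j by apply: dis gi gj; rewrite inE ?eqxx ?js ?orbT.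
by rewrite e js in si.
Qed.

Lemma leq_card_bigfcup (I T : choiceType) (B : I -> {fset T}) (s : seq I) :
  (#|` \bigcup_(i <- s) B i|%fset <= \sum_(i <- s) #|` B i|)%N.
Proof.
elim: s => [|i s IH] /=; first by rewrite !big_nil cardfs0.
rewrite !big_cons cardfsU; apply: leq_trans (leq_subr _ _) _.
by rewrite leq_add2l.
Qed.

Section Packing.
Variables (G : nmodType) (F : nat -> set G) (e d : nat).
Hypothesis FB : box_system F e d.
Local Notation W n := (fset_set (F n)).

Definition box (p : G) n : {fset G} := [fset (p + f)%R | f in W n]%fset.

Lemma in_window g n : (g \in W n) = `[< F n g >].
Proof. by rewrite in_fset_set ?inE //; apply: (box_finite FB). Qed.

Lemma boxP p n g : reflect (exists2 f, F n f & g = p + f) (g \in box p n).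
Proof.
apply: (iffP (imfsetP _ _ _ _)) => -[f]; rewrite /= ?in_window.
  by move=> /asboolP ? ?; exists f.
by move=> /asboolP ? ->; exists f; rewrite /= ?in_window.
Qed.

Lemma card_box p n : #|` box p n| = #|` W n|.
Proof. by rewrite /box card_imfset //; apply: (box_cancel FB). Qed.

Lemma mem_box_center p n : p \in box p n.
Proof. by apply/boxP; exists 0; rewrite ?addr0 //; apply: (box_zero FB). Qed.

Lemma card_window_gt0 n : (0 < #|` W n|)%N.
Proof. by rewrite (box_card FB) expn_gt0. Qed.

(** Positive dimension and rate make the windows grow without bound, so that powers q^|F_n| with q <
    1 become small. *)
Lemma card_window_ltn n : (n < #|` W n|)%N.
Proof.
rewrite (box_card FB); have := box_dim_gt0 FB; have := box_rate_gt0 FB.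
case: d => // k e0 _; rewrite expnS.
apply: (@leq_trans ((e * n).+1 * 1)); last by rewrite leq_mul2l expn_gt0.
by rewrite muln1 ltnS leq_pmull.
Qed.

(** 2en + 1 <= 2(en + 1). The doubling constant 2^d is what the greedy packing loses. *)
Lemma card_window_double n : (#|` W (n + n)| <= 2 ^ d * #|` W n|)%N.
Proof. by rewrite !(box_card FB) -expnMn leq_exp2r ?(box_dim_gt0 FB) //; lia. Qed.

Definition packed (T : {fset G}) (r : G -> nat) :=
  forall p q g, p \in T -> q \in T -> g \in box p (r p) -> g \in box q (r q) -> p = q.

Lemma card_packed T r : packed T r ->
  #|` \bigcup_(p <- T) box p (r p)|%fset = (\sum_(p <- T) #|` W (r p)|)%N.
Proof.
move=> pk; rewrite card_bigfcup_disjoint //; first by apply: eq_bigr => p _; rewrite card_box.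
Qed.

(* Greedy choice in order of decreasing size. *)
Lemma vitali (r : G -> nat) (S : {fset G}) : exists T : {fset G},
  [/\ (T `<=` S)%fset, packed T r &
      (#|` S| <= 2 ^ d * \sum_(p <- T) #|` W (r p)|)%N].
Proof.
have [n le_n] := ubnP #|` S|; elim: n => // n IH in S le_n *.
have [->|[p pS]] := fset_0Vmem S.
  by exists fset0; split; rewrite ?fsubset_refl ?cardfs0 // => p q g; rewrite inE.
have [p0 [p0S pmax]] : exists p0, p0 \in S /\ forall q, q \in S -> (r q <= r p0)%N.
  pose x0 : S := [` pS]%fset.
  case: (arg_maxnP (fun x : S => r (val x)) (erefl : xpredT x0)) => x _ xm.
  exists (val x); split; first exact: valP.
  by move=> q qS; have := xm [` qS]%fset erefl.
(* [B] contains every centre whose box of size at most [r p0] meets the box at [p0]. Discarding [B]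
   leaves boxes disjoint from the chosen one, which pays for [B] by doubling. *)
have [B cardB BP] := box_meet FB (r p0) (r p0) p0.
pose S' := (S `\` B)%fset.
have p0B : p0 \in B by apply: (BP _ 0 0) => //; apply: (box_zero FB).
have S'S : (S' `<=` S)%fset by rewrite fsubDset fsubsetUr.
have /IH [T' [T'S' pk cT']] : (#|` S'| < n)%N.
  rewrite -ltnS; apply: leq_trans le_n; rewrite ltnS; apply: fproper_ltn_card.
  by rewrite fproperEneq S'S andbT; apply/eqP => /fsetP/(_ p0); rewrite !inE p0B p0S.
have p0T' : p0 \notin T'.
  by apply/negP => /(fsubsetP T'S'); rewrite !inE p0B.
have sep q g : q \in T' -> g \in box p0 (r p0) -> g \in box q (r q) -> False.
  move=> qT /boxP[f Ff ->] /boxP[f' Ff' eqg].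
  have := fsubsetP T'S' _ qT; rewrite !inE => /andP[/negP + qS]; apply.
  apply: (BP _ f' f) => //; apply: (box_homo FB) Ff'; exact: pmax.
exists (p0 |` T')%fset; split.
- apply/fsubsetP => q; rewrite !inE => /orP[/eqP-> //|/(fsubsetP T'S')].
  exact: (fsubsetP S'S).
- move=> p1 q g; rewrite !inE => /orP[/eqP->|pT] /orP[/eqP->|qT] // g1 g2.
  + by case: (sep q g).
  + by case: (sep p1 g).
  + exact: pk g1 g2.
- rewrite big_fsetU1 //= mulnDr.
  have cS : (#|` S| <= #|` B| + #|` S'|)%N.
    rewrite /S' cardfsD; have := fsubset_leq_card (fsubsetIl S B).
    have := fsubset_leq_card (fsubsetIr S B); lia.
  apply: leq_trans cS (leq_add _ cT').
  exact: leq_trans cardB (card_window_double _).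
Qed.

Variable R : realType.

(** The ratio of cardinalities is (1 + em / (en + 1))^d, which tends to 1. So a layer of fixed width
    [m] around a large box is negligible. *)
Lemma window_ratio (m : nat) (dl : R) : 0 < dl -> exists n0, forall n, (n0 <= n)%N ->
  #|` W (n + m)|%:R <= (1 + dl) * #|` W n|%:R :> R.
Proof.
move=> dl0.
have e0 := box_rate_gt0 FB.
have cv : ((1 + x : R) ^+ d @[x --> (0:R)] --> (1 + 0 : R) ^+ d).
  apply: (@continuous_comp _ _ _ (fun x : R => 1 + x) (fun x : R => x ^+ d)).
    by apply: continuousD; [exact: cvg_cst | exact: cvg_id].
  exact: exprn_continuous.
have : \forall x \near (0 : R), (1 + x) ^+ d < 1 + dl.
  apply: (@cvgr_lt _ _ _ _ _ _ cv); rewrite addr0 expr1n; lra.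
move=> /nbhs_ballP[eps /= eps0 H].
have /archi_boundP := divr_ge0 (ler0n R m) (ltW eps0).
set n0 := Num.bound _ => n0P.
exists n0 => n n0n.
rewrite !(box_card FB) !natrX.
have np : 0 < ((e * n).+1%:R : R) by rewrite ltr0n.
pose x : R := (e * m)%:R / (e * n).+1%:R.
have -> : ((e * (n + m)).+1%:R : R) = (1 + x) * (e * n).+1%:R.
  by rewrite mulrDl mul1r /x divfK ?gt_eqF // -natrD; congr (_%:R); lia.
rewrite exprMn ler_wpM2r ?exprn_ge0 ?ltW //; apply: H.
rewrite /ball /= sub0r normrN ger0_norm ?divr_ge0 //.
rewrite /x ltr_pdivrMr //.
have h1 : (m%:R : R) < n0%:R * eps by rewrite -ltr_pdivrMr.
have h2 : (n0%:R : R) <= n%:R by rewrite ler_nat.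
rewrite -natr1 !natrM.
have e1 : (0 : R) < e%:R by rewrite ltr0n.
rewrite mulrDr mulr1 ltr_wpDr ?ltW // mulrCA ltr_pM2l // (lt_le_trans h1) //.
by rewrite mulrC ler_wpM2l // ltW.
Qed.

End Packing.

(** * Tilings that leave a small part of a window uncovered *)

Section Tiling.
Variables (R : realType) (G : nmodType) (F : nat -> set G) (e d : nat).
Hypothesis FB : box_system F e d.
Variables (A : finType) (X : set (fullshift G A)).
Hypothesis shiftX : forall g x, X x -> X (shift_act g x).
Variable q : R.
Local Notation W n := (fset_set (F n)).

Section Family.
Variables (I : finType) (n : I -> nat) (y : I -> fullshift G A).

(** For q = 2^-s this is the s-dimensional Hausdorff sum, a cylinder over F_n being charged with
    diameter 2^-|F_n|. *)
Definition family_weight : R := \sum_i q ^+ #|` W (n i)|.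

(** The tile centred at [p] has type [c p], and [u] bounds the uncovered fraction of the window. *)
Definition tiles (x : fullshift G A) (N : nat) (u : R) (T : {fset G}) (c : G -> I) :=
  [/\ forall p, p \in T -> (box F p (n (c p)) `<=` W N)%fset,
      packed F T (n \o c),
      forall p f, p \in T -> F (n (c p)) f -> x (p + f) = y (c p) f &
      (1 - u) * #|` W N|%:R <= (\sum_(p <- T) #|` W (n (c p))|)%N%:R :> R].

End Family.

(** What vanishing s-dimensional measure provides when q = 2^-s; a cylinder is recorded by its size
    and a representative. *)
Definition fine_covers := forall (n0 : nat) (eta : R), 0 < eta ->
  exists (J : finType) (n : J -> nat) (y : J -> fullshift G A),
  [/\ forall j, (n0 <= n j)%N, family_weight n <= eta &
      forall x, X x -> exists j, forall g, F (n j) g -> x g = y j g].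

(** The family is fixed before [N] and [x], so the set of labels in the later count does not depend
    on the window. *)
Definition tileable (u : R) := forall (n0 : nat) (eta : R), 0 < eta ->
  exists (I : finType) (n : I -> nat) (y : I -> fullshift G A),
  [/\ forall i, (n0 <= n i)%N, family_weight n <= eta &
      exists N0, forall N, (N0 <= N)%N -> forall x, X x ->
        exists T c, tiles n y x N u T c].

Hypothesis coversX : fine_covers.

Lemma tileable1 : tileable 1.
Proof.
move=> n0 eta eta0; have [J [n [y [n0n we cov]]]] := coversX n0 eta0.
exists J, n, y; split=> //; exists 0%N => N _ x Xx.
(* The tiling is empty; [j] only serves as a value of the total function [c]. *)
have [j _] := cov x Xx.
exists fset0, (fun=> j); split=> //.
by rewrite subrr mul0r ler0n.
Qed.

(* Points of the uncovered region [U] whose box of size [m] leaves [U] lie near the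
   boundary of the window or of a tile; both boundary layers are thin. *)
Lemma card_uncovered_interior (m n1 N : nat) (dl : R) (T : {fset G}) (r : G -> nat) :
  0 < dl ->
  (forall n, (n1 <= n)%N -> #|` W (n + m)|%:R <= (1 + dl) * #|` W n|%:R :> R) ->
  (n1 + m <= N)%N -> (forall p, p \in T -> (n1 <= r p)%N) ->
  packed F T r -> (forall p, p \in T -> (box F p (r p) `<=` W N)%fset) ->
  forall U : {fset G}, U = (W N `\` \bigcup_(p <- T) box F p (r p))%fset ->
  #|` U|%:R <= #|` [fset p in U | (box F p m `<=` U)%fset]%fset|%:R
               + 2 * dl * #|` W N|%:R :> R.
Proof.
move=> dl0 thin n1N n1r pk TN U ->{U}; set U := (W N `\` _)%fset.
set S := [fset p in U | _]%fset.
set Cov := (\bigcup_(p <- T) box F p (r p))%fset.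
have inW := in_window FB.
have mem_Cov g : reflect (exists2 p, p \in T & g \in box F p (r p)) (g \in Cov).
  apply: (iffP (bigfcupP _ _ _ _)) => -[p].
    by rewrite andbT; exists p.
  by move=> pT gp; exists p; rewrite ?pT.
have CovN : (Cov `<=` W N)%fset.
  by apply/fsubsetP => g /mem_Cov[p pT]; apply/fsubsetP/TN.
have /choice[B BP] : forall p : G, exists B : {fset G},
    (#|` B| <= #|` W (r p + m)|)%N /\
    forall p' f f', F m f -> F (r p) f' -> p' + f = p + f' -> p' \in B.
  by move=> p; have [B ? ?] := box_meet FB m (r p) p; exists B.
(* [E1] is the layer inside the boundary of the window, and [E2] collects the layers around the
   tiles: points outside a tile whose box of size [m] may meet it. *)
pose E1 := (W N `\` W (N - m))%fset.
pose E2 := (\bigcup_(p <- T) (B p `\` box F p (r p)))%fset.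
have US : (U `<=` S `|` (E1 `|` E2))%fset.
  apply/fsubsetP => p pU; rewrite in_fsetU; case: (boolP (p \in S)) => //= pS.
  move: (pU); rewrite inE => /andP[pC pN].
  have memS : (p \in S) = (p \in U) && (box F p m `<=` U)%fset by rewrite /S !inE.
  move: pS; rewrite memS pU /= => /fsubsetPn[g /(boxP FB)[f Ff ->]].
  rewrite !inE negb_and negbK => /orP[/mem_Cov[p' p'T p'g]|].
    apply/orP; right; apply/bigfcupP; exists p'; rewrite ?p'T // !inE.
    apply/andP; split.
      by apply: contraNN pC => h; apply/mem_Cov; exists p'.
    by move/(boxP FB): p'g => [f' Ff' eqg]; apply: (BP p').2 Ff Ff' eqg.
  move=> pfN; apply/orP; left; rewrite pN andbT; apply: contraNN pfN.
  rewrite !inW => /asboolP Fp; apply/asboolP.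
  by rewrite -(@subnK m N); [exact: (box_add FB)|lia].
have monW k l : (k <= l)%N -> (W k `<=` W l)%fset.
  move=> kl; apply/fsubsetP => g; rewrite !inW => /asboolP h; apply/asboolP.
  exact: (box_homo FB) kl _ h.
have cE1 : #|` E1|%:R <= dl * #|` W N|%:R :> R.
  rewrite cardfsDS ?monW ?leq_subr // natrB ?fsubset_leq_card ?monW ?leq_subr //.
  have := thin (N - m)%N; rewrite subnK; last lia.
  move=> /(_ ltac:(lia)) h.
  have h2 : #|` W (N - m)|%:R <= #|` W N|%:R :> R.
    by rewrite ler_nat fsubset_leq_card // monW // leq_subr.
  have : dl * #|` W (N - m)|%:R <= dl * #|` W N|%:R by rewrite ler_wpM2l // ltW.
  lra.
(* Each layer is at most [dl] times its tile, and the tiles are disjoint in the window. *)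
have cE2 : #|` E2|%:R <= dl * #|` W N|%:R :> R.
  apply: (@le_trans _ _ (dl * #|` Cov|%:R)); last first.
    by rewrite ler_wpM2l ?(ltW dl0) // ler_nat fsubset_leq_card.
  rewrite (card_packed FB) // natr_sum mulr_sumr.
  apply: (@le_trans _ _ (\sum_(p <- T) #|` (B p `\` box F p (r p))%fset|)%N%:R).
    by rewrite ler_nat leq_card_bigfcup.
  rewrite natr_sum big_seq [leRHS]big_seq; apply: ler_sum => p pT.
  have BB : (box F p (r p) `<=` B p)%fset.
    apply/fsubsetP => g /(boxP FB)[f Ff ->].
    by apply: ((BP p).2 _ 0 f) => //; [exact: (box_zero FB)|rewrite addr0].
  rewrite cardfsDS // natrB ?fsubset_leq_card // (card_box FB).
  have := thin _ (n1r _ pT).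
  have : #|` B p|%:R <= #|` W (r p + m)|%:R :> R by rewrite ler_nat (BP p).1.
  lra.
have : #|` U|%:R <= (#|` S| + (#|` E1| + #|` E2|))%:R :> R.
  rewrite ler_nat; apply: leq_trans (fsubset_leq_card US) _.
  rewrite cardfsU; apply: leq_trans (leq_subr _ _) _.
  by rewrite leq_add2l cardfsU leq_subr.
rewrite !natrD; lra.
Qed.

(** The new tiles have sizes at most [m], fixed first; the old tiles are then taken so large that
    layers of width [m] around them are thin. Vitali packing fills with new tiles at least 2^-d of
    the interior of the uncovered part. Each family gets half of [eta]. *)
Lemma tileable_step u : 0 < u -> tileable u -> tileable ((1 - (2 ^+ d)^-1 / 2) * u).
Proof.
move=> u0 tu n0 eta eta0.
have eta2 : 0 < eta / 2 by rewrite divr_gt0.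
have [J [nJ [yJ [n0J wJ covJ]]]] := coversX n0 eta2.
pose m := (\max_j nJ j)%N.
(* Two kinds of layers, each at most u / 4 of the window, cost u / 2 in total. *)
have u4 : 0 < u / 4 by rewrite divr_gt0.
have [n1 thin] := window_ratio FB m u4.
have [I [nI [yI [n01I wI [N0 tI]]]]] := tu (n0 + n1)%N _ eta2.
pose n (k : I + J) := match k with inl i => nI i | inr j => nJ j end.
pose y (k : I + J) := match k with inl i => yI i | inr j => yJ j end.
exists (I + J)%type, n, y; split.
- by case=> [i|j] //=; apply: leq_trans (n01I i); rewrite leq_addr.
- rewrite /family_weight big_sumType /=; move: wI wJ; rewrite /family_weight; lra.
exists (N0 + n1 + m)%N => N NN x Xx.
have [T [c [TN pk Tx Tc]]] := tI N ltac:(lia) x Xx.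
(* Shift invariance: [shift_act p x] lies in [X], so some cylinder of the cover describes [x] around
   any point [p]. *)
have /choice[j jP] : forall p, exists j, forall f, F (nJ j) f -> x (p + f) = yJ j f.
  by move=> p; have [j h] := covJ _ (shiftX p Xx); exists j.
have := @card_uncovered_interior m n1 N (u / 4) T (nI \o c) u4 thin ltac:(lia) _ pk TN.
have n1c p : p \in T -> (n1 <= (nI \o c) p)%N.
  by move=> _; apply: leq_trans (n01I _); rewrite leq_addl.
move=> /(_ n1c _ erefl) /=.
set Cov := (\bigcup_(p <- T) _)%fset; set U := (W N `\` Cov)%fset.
set S := [fset p in U | _]%fset => cU.
have [T1 [T1S pk1 cT1]] := vitali FB (nJ \o j) S.
have mem_Cov p g : p \in T -> g \in box F p (nI (c p)) -> g \in Cov.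
  by move=> pT gp; apply/bigfcupP; exists p; rewrite ?pT.
have T1U p g : p \in T1 -> g \in box F p (nJ (j p)) -> g \in U.
  move=> /(fsubsetP T1S); rewrite inE /= => /andP[_ /fsubsetP pU] /(boxP FB)[f Ff ->].
  apply: pU; apply/(boxP FB); exists f => //.
  by apply: (box_homo FB) Ff; exact: leq_bigmax.
have T1T p : p \in T1 -> p \notin T.
  move=> pT1; have := T1U p p pT1 (mem_box_center FB _ _); rewrite inE => /andP[+ _].
  by apply: contraNN => pT; apply: mem_Cov pT (mem_box_center FB _ _).
pose c' p : I + J := if p \in T then inl (c p) else inr (j p).
have c'T p : p \in T -> c' p = inl (c p) by rewrite /c' => ->.
have c'T1 p : p \in T1 -> c' p = inr (j p) by move=> /T1T; rewrite /c' => /negPf ->.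
have disTT1 p p' g : p \in T -> p' \in T1 -> g \in box F p (nI (c p)) ->
    g \in box F p' (nJ (j p')) -> False.
  move=> pT p'T1 gp gp'; have := T1U _ _ p'T1 gp'.
  by rewrite inE (mem_Cov p).
exists (T `|` T1)%fset, c'; split.
- move=> p /fsetUP[pT|pT1]; first by rewrite c'T //; exact: TN.
  rewrite c'T1 //; apply/fsubsetP => g /(T1U _ _ pT1).
  by rewrite inE => /andP[].
- move=> p p' g /fsetUP[pT|pT] /fsetUP[p'T|p'T] /=;
    rewrite ?(c'T p pT) ?(c'T1 p pT) ?(c'T p' p'T) ?(c'T1 p' p'T) /= => gp gp'.
  + exact: pk gp gp'.
  + by case: (disTT1 p p' g).
  + by case: (disTT1 p' p g).
  + exact: pk1 gp gp'.
- move=> p f /fsetUP[pT|pT]; rewrite ?(c'T p pT) ?(c'T1 p pT) /=; first exact: Tx.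
  exact: jP.
have TT1 : perm_eq (T `|` T1)%fset (enum_fset T ++ enum_fset T1).
  apply: uniq_perm; first exact: fset_uniq.
    rewrite cat_uniq !fset_uniq andbT /=; apply/hasPn => p; exact: T1T.
  by move=> p; rewrite mem_cat in_fsetU.
rewrite (perm_big _ TT1) big_cat /= (eq_big_seq (fun p => #|` W (nI (c p))|)); last first.
  by move=> p pT; rewrite c'T.
rewrite [X in (_ + X)%N](eq_big_seq (fun p => #|` W (nJ (j p))|)); last first.
  by move=> p pT; rewrite c'T1.
have cC : #|` Cov| = (\sum_(p <- T) #|` W (nI (c p))|)%N by rewrite (card_packed FB).
have CN : (Cov `<=` W N)%fset.
  apply/fsubsetP => g /bigfcupP[p]; rewrite andbT => pT; exact/fsubsetP/TN.
have cUE : #|` U|%:R = #|` W N|%:R - #|` Cov|%:R :> R.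
  by rewrite cardfsDS // natrB // fsubset_leq_card.
rewrite -cC in Tc *; rewrite natrD.
set s1 := (\sum_(p <- T1) _)%N in cT1 *.
move: cT1; rewrite -(ler_nat R) natrM natrX => cT1.
have D0 : 0 < (2 ^+ d : R) by rewrite exprn_gt0.
have D1 : (2 ^+ d : R)^-1 <= 1 by rewrite invf_le1 // exprn_ege1 // ler1n.
have Di : 0 < (2 ^+ d : R)^-1 by rewrite invr_gt0.
have s1P : (2 ^+ d)^-1 * #|` S|%:R <= s1%:R :> R by rewrite mulrC ler_pdivrMr // mulrC.
move: s1P Di D1; set k := (2 ^+ d)^-1; set M := (#|` W N|%:R : R).
move: Tc cU; rewrite cUE -/M; set C := (#|` Cov|%:R : R) => Tc cU s1P k0 k1.
(* The part still uncovered is at most (1 - k)(M - C) + k u M / 2, and M - C <= u M; together this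
   is (1 - k / 2) u M. *)
have : k * (M - C - 2 * (u / 4) * M) <= s1%:R.
  by apply: le_trans s1P; rewrite ler_pM2l //; lra.
have : (1 - k) * (M - C) <= (1 - k) * (u * M) by rewrite ler_wpM2l //; lra.
nra.
Qed.

Lemma tileable_le u v : u <= v -> tileable u -> tileable v.
Proof.
move=> uv tu n0 eta eta0; have [I [n [y [h1 h2 [N0 h3]]]]] := tu n0 eta eta0.
exists I, n, y; split => //; exists N0 => N NN x Xx.
have [T [c [t1 t2 t3 t4]]] := h3 N NN x Xx; exists T, c; split => //.
apply: le_trans t4; rewrite ler_wpM2r //; lra.
Qed.

(** Starting from the empty tiling, k steps leave the fraction a^k, which tends to 0. *)
Lemma tileable_gt0 u : 0 < u -> tileable u.
Proof.
move=> u0; pose a : R := 1 - (2 ^+ d)^-1 / 2.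
have Di : 0 < (2 ^+ d : R)^-1 by rewrite invr_gt0 exprn_gt0.
have D1 : (2 ^+ d : R)^-1 <= 1 by rewrite invf_le1 ?exprn_gt0 // exprn_ege1 // ler1n.
have a0 : 0 < a by rewrite /a; lra.
have a1 : `|a| < 1 by rewrite ger0_norm ?ltW // /a; lra.
have taX k : tileable (a ^+ k).
  elim: k => [|k IH]; first by rewrite expr0; exact: tileable1.
  by rewrite exprS; apply: tileable_step => //; exact: exprn_gt0.
have [k _ /(_ k (leqnn k)) /= ak] : \forall k \near \oo, a ^+ k < u.
  exact: (cvgr_lt _ (cvg_expr a1)).
exact: tileable_le (ltW ak) (taX k).
Qed.

End Tiling.

(** * Counting patterns by weighted labellings *)

Section Counting.
Variables (R : realType) (G : nmodType) (F : nat -> set G) (e d : nat).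
Hypothesis FB : box_system F e d.
Variables (A : finType) (X : set (fullshift G A)).
Local Notation W n := (fset_set (F n)).

Definition pattern N (x : fullshift G A) : {ffun W N -> A} := [ffun g => x (val g)].

Definition patterns N : {set {ffun W N -> A}} :=
  [set w | `[< exists2 x, X x & pattern N x = w >]].

Lemma patternsP N w : reflect (exists2 x, X x & pattern N x = w) (w \in patterns N).
Proof. by rewrite inE; exact: asboolP. Qed.

Section Labels.
Variables (I : finType) (n : I -> nat) (y : I -> fullshift G A) (q t : R).
Hypotheses (q_gt0 : 0 < q) (q_le1 : q <= 1) (t_gt0 : 0 < t) (t_le1 : t <= 1).

(* A tiled configuration is encoded by labelling each tile centre with its tile,
   each uncovered point with its letter, and all other points with [None]. *)
Definition label_weight (l : option (I + A)) : R :=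
  match l with
  | None => 1
  | Some (inl i) => q ^+ #|` W (n i)|
  | Some (inr _) => t
  end.

Definition decodes N (l : {ffun W N -> option (I + A)}) (w : {ffun W N -> A}) :=
  [/\ forall p i f g, l p = Some (inl i) -> F (n i) f -> val g = val p + f -> w g = y i f,
      forall g a, l g = Some (inr a) -> w g = a &
      forall g, (exists a, l g = Some (inr a)) \/
        (exists p i f, [/\ l p = Some (inl i), F (n i) f & val g = val p + f])].

(** By the third clause of [decodes] every point is either lettered or inside a marked tile, so a
    labelling determines its pattern. *)
Lemma decodes_inj N (l : {ffun W N -> option (I + A)}) w w' :
  decodes l w -> decodes l w' -> w = w'.
Proof.
move=> [h1 h2 h3] [h1' h2' _]; apply/ffunP => g.
case: (h3 g) => [[a la]|[p [i [f [lp Ff gp]]]]].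
  by rewrite (h2 _ _ la) (h2' _ _ la).
by rewrite (h1 _ _ _ _ lp Ff gp) (h1' _ _ _ _ lp Ff gp).
Qed.

(** By distributivity the sum over labellings of products over points is the product over points of
    the total weight of one label. *)
Lemma sum_label_weight N :
  \sum_(l : {ffun W N -> option (I + A)}) \prod_g label_weight (l g) =
  (1 + family_weight F q n + #|A|%:R * t) ^+ #|` W N|.
Proof.
rewrite -(bigA_distr_bigA (fun=> label_weight)) /= prodr_const cardfE; congr (_ ^+ _).
rewrite (bigD1 None) //= -addrA; congr (_ + _).
rewrite (reindex_omap Some id) //=; last by case.
rewrite (eq_bigl xpredT) => [|x]; last by rewrite eqxx.
rewrite big_sumType /=; congr (_ + _).
by rewrite sumr_const mulr_natl.
Qed.

(** If the tiles cover [m] points, the labelling weighs q^m t^(|F_N| - m). Since q, t <= 1, this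
    only decreases when m is raised to |F_N| and |F_N| - m to u |F_N|, a real exponent. *)
Lemma tiles_label x N u T c : tiles F n y x N u T c ->
  exists2 l, decodes l (pattern N x) &
    q ^+ #|` W N| * t `^ (u * #|` W N|%:R) <= \prod_g label_weight (l g).
Proof.
move=> [TN pk Tx Tc].
pose C := (\bigcup_(p <- T) box F p (n (c p)))%fset.
have mem_C g : reflect (exists2 p, p \in T & g \in box F p (n (c p))) (g \in C).
  apply: (iffP (bigfcupP _ _ _ _)) => -[p].
    by rewrite andbT; exists p.
  by move=> pT gp; exists p; rewrite ?pT.
have TC p : p \in T -> p \in C.
  by move=> pT; apply/mem_C; exists p => //; exact: (mem_box_center FB).
have CN : (C `<=` W N)%fset.
  by apply/fsubsetP => g /mem_C[p pT]; apply/fsubsetP/TN.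
have TNs : (T `<=` W N)%fset by apply/fsubsetP => p /TC; apply/fsubsetP.
pose l : {ffun W N -> option (I + A)} := [ffun g : W N =>
  if val g \in T then Some (inl (c (val g)))
  else if val g \in C then None else Some (inr (x (val g)))].
exists l.
  split.
  - move=> p i f g; rewrite !ffunE; case: ifP => [pT [<-] Ff ->|_]; first exact: Tx.
    by case: ifP.
  - by move=> g a; rewrite !ffunE; case: ifP => // _; case: ifP => // _ [->].
  - move=> g; rewrite ffunE; case: ifP => [gT|_].
      right; exists g, (c (val g)), 0; rewrite ffunE gT addr0; split=> //.
      exact: (box_zero FB).
    case: ifP => [/mem_C[p pT /(boxP FB)[f Ff gp]]|_]; last by left; exists (x (val g)).
    right; exists [` fsubsetP TNs _ pT]%fset, (c p), f.
    by rewrite ffunE /= pT.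
pose m : nat := (\sum_(p <- T) #|` W (n (c p))|)%N.
have cC : #|` C| = m by rewrite (card_packed FB pk).
have -> : \prod_g label_weight (l g) = q ^+ m * t ^+ (#|` W N| - m)%N.
  rewrite (eq_bigr (fun g : W N =>
      (if val g \in T then q ^+ #|` W (n (c (val g)))| else 1) *
      (if val g \notin C then t else 1))); last first.
    move=> g _; rewrite ffunE; case: ifP => [gT|_] /=; first by rewrite TC //= mulr1.
    by rewrite mul1r; case: ifP.
  rewrite big_split /=; congr (_ * _).
    rewrite -(big_seq_fsetE _ _ xpredT
      (fun g => if g \in T then q ^+ #|` W (n (c g))| else 1)) /=.
    rewrite -(big_fset_incl _ TNs) => [|g _ /negPf -> //].
    rewrite big_seq (eq_bigr (fun p => q ^+ #|` W (n (c p))|)) => [|p ->//].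
    by rewrite -big_seq prodrXr.
  rewrite -(big_seq_fsetE _ _ xpredT (fun g => if g \notin C then t else 1)) /=.
  rewrite -(big_fset_incl _ (fsubsetDl (W N) C)); last first.
    by move=> g gN; rewrite inE gN andbT negbK => ->.
  rewrite big_seq (eq_bigr (fun=> t)) => [|p]; last by rewrite inE => /andP[->].
  by rewrite -big_seq big_const_seq count_predT iter_mulr_1 cardfsDS // cC.
have mN : (m <= #|` W N|)%N by rewrite -cC fsubset_leq_card.
apply: ler_pM; rewrite ?exprn_ge0 ?powR_ge0 ?(ltW q_gt0) //.
  by apply: ler_wiXn2l => //; exact: ltW.
rewrite -powR_mulrn ?(ltW t_gt0) //; apply: ger_powR; first by rewrite t_gt0.
rewrite natrB // lerBlDl -lerBlDr; move: Tc; rewrite -/m; lra.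
Qed.

End Labels.

Lemma card_patterns_le (q : R) (eps : R) : 0 < q -> q <= 1 -> 0 < eps ->
  (forall g x, X x -> X (shift_act g x)) -> fine_covers F X q ->
  exists N0, forall N, (N0 <= N)%N ->
    #|patterns N|%:R * q ^+ #|` W N| <= (1 + eps) ^+ #|` W N|.
Proof.
move=> q0 q1 eps0 shX cov.
(* The letters together weigh at most eps / 4, as does the family chosen below, so one point has
   total label weight at most 1 + eps / 2. *)
pose t := Num.min 1 (eps / 4 / (#|A|%:R + 1)).
have a0 : 0 < (#|A|%:R + 1 : R) by rewrite ltr_wpDl.
have t0 : 0 < t by rewrite /t lt_min ltr01 !divr_gt0.
have t1 : t <= 1 by rewrite /t ge_min lexx.
have At : #|A|%:R * t <= eps / 4.
  have : t * (#|A|%:R + 1) <= eps / 4 by rewrite -ler_pdivlMr // /t ge_min lexx orbT.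
  rewrite mulrDr mulr1 mulrC; lra.
have lnt : ln t <= 0 by rewrite ln_le0.
(* Chosen so that t^u >= 1 + u ln t makes up the gap between 1 + eps / 2 and 1 + eps. The
   denominator has 1 - ln t, which stays positive when t = 1. *)
pose u := eps / 2 / ((1 + eps) * (1 - ln t)).
have ep1 : 0 < 1 + eps by lra.
have lt1 : 0 < 1 - ln t by lra.
have u0 : 0 < u by rewrite !divr_gt0 // mulr_gt0.
have tu : 1 + eps / 2 <= (1 + eps) * t `^ u.
  have h : 1 + u * ln t <= t `^ u by rewrite /powR gt_eqF // expR_ge1Dx.
  have : (1 + eps) * (1 + u * ln t) <= (1 + eps) * t `^ u by rewrite ler_pM2l.
  have : u * (1 + eps) * (1 - ln t) = eps / 2.
    by rewrite /u -mulrA divfK // mulf_neq0 ?gt_eqF.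
  have : 0 < u * (1 + eps) by rewrite mulr_gt0.
  nra.
have eps4 : 0 < eps / 4 by rewrite divr_gt0.
have [I [n [y [_ wn [N0 tilesX]]]]] := tileable_gt0 FB shX cov u0 0%N eps4.
exists N0 => N NN; set M := #|` W N|.
pose wt (l : {ffun W N -> option (I + A)}) := \prod_g label_weight n q t (l g).
have wt_ge0 l : 0 <= wt l.
  apply: prodr_ge0 => g _; case: (l g) => [[i|a]|] //=; last exact: ltW.
  by rewrite exprn_ge0 // ltW.
have /choice[phi phiP] : forall w : {ffun W N -> A}, exists l : {ffun W N -> option (I + A)},
    w \in patterns N -> decodes n y l w /\ q ^+ M * t `^ (u * M%:R) <= wt l.
  move=> w; case: (boolP (w \in patterns N)) => [/patternsP[x Xx <-]|_]; last first.
    by exists [ffun=> None].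
  have [T [c tl]] := tilesX N NN x Xx.
  by have [l dl wl] := tiles_label q0 q1 t0 t1 tl; exists l.
have phi_inj : {in patterns N &, injective phi}.
  move=> w w' /phiP[dw _] /phiP[dw' _] eqphi.
  by apply: decodes_inj dw _; rewrite eqphi.
have count : #|patterns N|%:R * (q ^+ M * t `^ (u * M%:R)) <= (1 + eps / 2) ^+ M.
  apply: (@le_trans _ _ (\sum_l wt l)).
    rewrite mulr_natl -sumr_const.
    apply: (@le_trans _ _ (\sum_(w in patterns N) wt (phi w))).
      by apply: ler_sum => w /phiP[].
    rewrite -(big_imset _ phi_inj) /= [leRHS](bigID (mem (phi @: patterns N))) /=.
    by rewrite lerDl sumr_ge0.
  rewrite /wt sum_label_weight; apply: lerXn2r; rewrite ?nnegrE; last 2 first.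
  - lra.
  - move: wn; lra.
  - rewrite -!addrA !addr_ge0 ?mulr_ge0 ?ler0n ?(ltW t0) ?ler01 //.
    by apply: sumr_ge0 => i _; rewrite exprn_ge0 // ltW.
have : #|patterns N|%:R * q ^+ M * t `^ (u * M%:R) <= (1 + eps) ^+ M * t `^ (u * M%:R).
  rewrite -mulrA; apply: le_trans count _.
  rewrite powRrM powR_mulrn ?powR_ge0 // -exprMn.
  by apply: lerXn2r; rewrite ?nnegrE ?mulr_ge0 ?powR_ge0 //; lra.
by rewrite ler_pM2r // powR_gt0.
Qed.

End Counting.

(** * Cylinders and compactness of the full shift *)

Section Topology.
Variables (G : nmodType) (F : nat -> set G) (e d : nat).
Hypothesis FB : box_system F e d.
Variables (A : finType).
Local Notation W n := (fset_set (F n)).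

Definition cylinder (x : fullshift G A) n : set (fullshift G A) :=
  [set z | forall g, F n g -> z g = x g].

Lemma cylinder_homo x m n : (m <= n)%N -> cylinder x n `<=` cylinder x m.
Proof. by move=> mn z xz g /(box_homo FB mn) /xz. Qed.

Lemma open_cylinder x n : open (cylinder x n).
Proof.
rewrite openE => z xz; rewrite /interior.
have -> : cylinder x n = \bigcap_(g in [set` W n]) [set z : fullshift G A | z g = x g].
  apply/seteqP; split => z' h g /=.
    by rewrite (in_window FB) => /asboolP; exact: h.
  by move=> Fg; apply: h; rewrite /= (in_window FB); apply/asboolP.
apply: filter_bigI => g; rewrite (in_window FB) => /asboolP Fg.
have : nbhs (z g : discrete_topology A) [set x g].
  by rewrite -(xz g Fg); exact: discrete_set1.
exact: (@proj_continuous G (fun=> discrete_topology A) g z).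
Qed.

(** The filter generated by the cylinders around [x] converges to [x] in each coordinate, as every
    point of [G] lies in some window; hence it converges in the product. *)
Lemma open_cylinder_sub (V : set (fullshift G A)) x :
  open V -> V x -> exists n, cylinder x n `<=` V.
Proof.
move=> oV Vx.
pose Fx := filter_from [set: nat] (cylinder x).
have FxF : Filter Fx.
  apply: filter_from_filter; first by exists 0%N.
  move=> m n _ _; exists (maxn m n) => // z xz; split; apply: cylinder_homo xz.
    exact: leq_maxl.
  exact: leq_maxr.
have : Fx --> x.
  apply/cvg_sup => g B /=.
  case=> _ [[V' oV' <-] Vg VB]; rewrite /= in Vg.
  have [n Fng] := box_exhaust FB g.
  exists n => // z xz; apply: VB => /=; rewrite /preimage /= xz //.
by move=> /(_ V) []; [exact: open_nbhs_nbhs|move=> n _ h; exists n].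
Qed.

Lemma fullshift_compact (a : A) : compact [set: fullshift G A].
Proof.
have := @tychonoff G (fun=> discrete_topology A) (fun=> setT).
have cA : compact [set: discrete_topology A].
  by apply: finite_compact; exact: (@finite_finset A).
move=> /(_ (fun=> cA)); congr compact; apply/seteqP; split => //.
Qed.

Lemma closed_finite_subcover (X : set (fullshift G A)) (I : choiceType) (D : set I)
    (f : I -> set (fullshift G A)) :
  X !=set0 -> closed X -> (forall i, D i -> open (f i)) -> X `<=` \bigcup_(i in D) f i ->
  exists2 D' : {fset I}, {subset D' <= D} & X `<=` \bigcup_(i in [set` D']) f i.
Proof.
move=> [x0 Xx0] clX fo Xf.
pose P : ptopologicalType := HB.pack (fullshift G A) (isPointed.Build (fullshift G A) x0).
have cX : compact (X : set P).
  apply: (@subclosed_compact P) (@fullshift_compact (x0 0)) _ => //.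
have := cX; rewrite (@compact_cover P) => /(_ I D f fo Xf) [D' ? ?].
by exists D'.
Qed.

End Topology.

(** * The standard metric, Hausdorff measure and covers by cylinders *)

Lemma greatestP (P : set nat) b : P 0%N -> (forall m, P m -> (m <= b)%N) ->
  P (greatest P) /\ forall m, P m -> (m <= greatest P)%N.
Proof.
move=> P0 Pb; suff [n nP] : [set n | P n /\ forall m, P m -> (m <= n)%N] !=set0.
  exact: xgetI nP.
have exP : exists n, `[< P n >] by exists 0%N; apply/asboolP.
have Pb' n : `[< P n >] -> (n <= b)%N by move=> /asboolP; exact: Pb.
exists (ex_maxn exP Pb'); case: ex_maxnP => n /asboolP Pn nmax; split=> // m Pm.
by apply: nmax; apply/asboolP.
Qed.

(** Distinct exponents pick distinct terms of a geometric series. It serves to share one tolerance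
    among the members of a countable cover. *)
Lemma sum_half_pow_uniq (R : realType) (I : eqType) (f : I -> nat) (s : seq I) :
  uniq s -> {in s &, injective f} -> \sum_(i <- s) 2 ^- (f i).+1 <= 1 :> R.
Proof.
move=> us finj; pose h k : R := 2 ^- k.+1.
have h0 k : 0 <= h k by rewrite invr_ge0 exprn_ge0.
have sum_h m : \sum_(0 <= k < m) h k = 1 - 2 ^- m.
  elim: m => [|m IH]; first by rewrite big_geq // expr0 invr1 subrr.
  rewrite big_nat_recr //= IH /h exprS; have : (2 ^+ m : R) != 0 by rewrite expf_neq0.
  by move=> ?; field.
have ufs : uniq (map f s) by rewrite map_inj_in_uniq.
rewrite -(big_map f xpredT h).
pose m := (\max_(k <- map f s) k).+1.
have bound k : k \in map f s -> (k < m)%N.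
  by move=> ks; rewrite ltnS; exact: (@leq_bigmax_seq _ _ _ id).
have -> : \sum_(k <- map f s) h k = \sum_(0 <= k < m | k \in map f s) h k.
  rewrite -[RHS]big_filter; apply: perm_big; apply: uniq_perm => //.
    by rewrite filter_uniq // iota_uniq.
  move=> k; rewrite mem_filter mem_index_iota /= andb_idr //; exact: bound.
apply: (@le_trans _ _ (\sum_(0 <= k < m) h k)).
  by rewrite big_mkcond; apply: ler_sum => k _; case: ifP.
by rewrite sum_h lerBlDr lerDl invr_ge0 exprn_ge0.
Qed.

Section Hausdorff.
Variables (R : realType) (G : nmodType) (F : nat -> set G) (e d : nat).
Hypothesis FB : box_system F e d.
Variables (A : finType).
Local Notation W n := (fset_set (F n)).
Local Notation rho := (rho R F).
Local Notation diam := (@diam R G A F).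
Local Notation radius k := (2 ^- #|` fset_set (window F k)| : R).

Lemma window_homo j k : (j <= k)%N -> window F j `<=` window F k.
Proof. by case: j k => [|j] [|k] //= jk; [exact: subset_refl|exact: sub0set|exact: (box_homo FB)]. Qed.

Lemma finite_window k : finite_set (window F k).
Proof. by case: k => [|k] /=; [exact: finite_set0|exact: (box_finite FB)]. Qed.

Lemma radius_homo j k : (j <= k)%N -> radius k <= radius j.
Proof.
move=> jk; rewrite ler_pV2 ?inE ?unitfE ?expf_neq0 ?exprn_gt0 //.
rewrite ler_eXn2l ?ltr1n // fsubset_leq_card //; apply/fsubsetP => g.
rewrite !in_fset_set; try exact: finite_window.
by move=> /set_mem/(window_homo jk)/mem_set.
Qed.

Lemma radius_ge0 k : 0 <= radius k.
Proof. by rewrite invr_ge0 exprn_ge0. Qed.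

Lemma radius_le1 k : radius k <= 1.
Proof. by rewrite invf_le1 ?exprn_gt0 // exprn_ege1 // ler1n. Qed.

Lemma agree_homo (x y : fullshift G A) j k : (j <= k)%N -> agree F x y k -> agree F x y j.
Proof. by move=> jk xy g /(window_homo jk) /xy. Qed.

Lemma agree_bounded (x y : fullshift G A) : x <> y ->
  exists b, forall k, agree F x y k -> (k <= b)%N.
Proof.
move=> xy; have [g xyg] : exists g, x g <> y g.
  by apply/existsNP => h; apply: xy; apply/funext.
have [b Fg] := box_exhaust FB g; exists b => k; rewrite leqNgt; apply: contraPN => bk.
by move=> /(agree_homo bk)/(_ g Fg).
Qed.

Lemma rho_ge0 (x y : fullshift G A) : 0 <= rho x y :> R.
Proof. by rewrite /Defs.rho; case: asboolP => // _; exact: radius_ge0. Qed.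

Lemma rho_le_radius (x y : fullshift G A) k : agree F x y k -> rho x y <= radius k.
Proof.
move=> xyk; rewrite /Defs.rho; case: asboolP => [_|xy]; first exact: radius_ge0.
have [b bP] := agree_bounded xy; have [//|_ gmax] := greatestP _ bP.
by apply: radius_homo; exact: gmax.
Qed.

(** Windows are nested, so disagreement on window k + 1 keeps the largest window of agreement at
    index at most k. *)
Lemma rho_ge_radius (x y : fullshift G A) k : ~ agree F x y k.+1 -> radius k <= rho x y.
Proof.
move=> nxy; rewrite /Defs.rho; case: asboolP => [xy|xy]; first by case: nxy; rewrite xy.
have [b bP] := agree_bounded xy; have [//|xyg _] := greatestP _ bP.
apply: radius_homo; rewrite leqNgt; apply/negP => kg.
by apply: nxy; exact: agree_homo kg xyg.
Qed.

Lemma rho_le_diam E x y : E x -> E y -> rho x y <= diam E.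
Proof.
move=> Ex Ey; apply: ub_le_sup; last by exists (x, y).
(* The distances are bounded by 1, so the supremum in [diam] is a genuine one. *)
exists 1 => _ [p _ <-]; apply: le_trans (radius_le1 0).
by apply: rho_le_radius => g [].
Qed.

Lemma diam_ge0 E : 0 <= diam E.
Proof.
have [[x Ex]|/set0P/negP/negPn/eqP ->] := pselect (E !=set0).
  exact: le_trans (rho_ge0 x x) (rho_le_diam Ex Ex).
by rewrite /Defs.diam set0X image_set0 sup0.
Qed.

Lemma diam_le E b : 0 <= b -> (forall x y, E x -> E y -> rho x y <= b) -> diam E <= b.
Proof.
move=> b0 Eb; have [[x Ex]|/set0P/negP/negPn/eqP ->] := pselect (E !=set0).
  apply: ge_sup; first by exists (rho x x); exists (x, x).
  by move=> _ [[y z] /= [Ey Ez] <-]; exact: Eb.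
(* The empty set has diameter 0 because [sup] is 0 there; this is where [b] must be nonnegative. *)
by rewrite /Defs.diam set0X image_set0 sup0.
Qed.

Lemma invX_powR (s : R) (k : nat) : (2 ^- k) `^ s = (2 `^ (- s)) ^+ k.
Proof.
rewrite -powR_invn ?ler0n // -powRrM mulNr mulrC -mulNr powRrM.
by rewrite powR_mulrn // powR_ge0.
Qed.

Lemma radius_powR s k : (radius k) `^ s = (2 `^ (- s)) ^+ #|` fset_set (window F k)|.
Proof. exact: invX_powR. Qed.

Lemma half_powR_lt1 (s : R) : 0 < s -> 2 `^ (- s) < 1 :> R.
Proof.
move=> s0; rewrite /powR gt_eqF // -[ltRHS]expR0 ltr_expR mulNr oppr_lt0 mulr_gt0 //.
by rewrite ln_gt0 // ltr1n.
Qed.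

Lemma small_pow_window (q t : R) : 0 <= q < 1 -> 0 < t ->
  exists n0, forall n, (n0 <= n)%N -> q ^+ #|` W n| < t.
Proof.
move=> /andP[q0 q1] t0.
have cv : (fun n => q ^+ n) @ \oo --> (0 : R) by apply: cvg_expr; rewrite ger0_norm.
have [k _ kP] : \forall k \near \oo, q ^+ k < t by exact: (cvgr_lt _ cv).
exists k => n kn; apply: kP; exact: leq_trans kn (ltnW (card_window_ltn FB _)).
Qed.

(* A set on which all windows agree has diameter 0 and is enclosed in an arbitrarily
   small cylinder, at the cost of the tolerance [t]. *)
Lemma enclosing_cylinder (s t : R) (n0 : nat) (E : set (fullshift G A)) :
  0 <= s -> 0 < t -> E !=set0 -> diam E < 2 ^- #|` W n0| ->
  exists y n, [/\ (n0 <= n)%N, E `<=` cylinder F y n &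
    (2 `^ (- s)) ^+ #|` W n| <= diam E `^ s + t].
Proof.
move=> s0 t0 [y Ey] Esmall; exists y.
have [allk|/existsNP[k nk]] := pselect (forall k x, E x -> agree F x y k).
  have sub n : E `<=` cylinder F y n by move=> x Ex; exact: (allk n.+1).
  (* For s = 0 any size will do, since x^0 = 1 even at x = 0. For s > 0 a large cylinder weighs less
     than [t]. *)
  move: s0; rewrite le_eqVlt => /predU1P[<-|s0].
    by exists n0; split => //; rewrite oppr0 !powRr0 expr1n lerDl ltW.
  have [|n1 n1P] := @small_pow_window (2 `^ (- s)) t _ t0.
    by rewrite powR_ge0 half_powR_lt1.
  exists (maxn n0 n1); split => //; first exact: leq_maxl.
  by apply: ltW; rewrite ltr_wpDl ?powR_ge0 // n1P // leq_maxr.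
(* At the first window k' + 1 where [E] disagrees with [y], the set still lies in the cylinder over
   window k' and has diameter at least [radius k']. *)
have exk : exists k, `[< ~ forall x, E x -> agree F x y k >] by exists k; apply/asboolP.
case: (ex_minnP exk) => -[|k'] /asboolP + kmin; first by case=> x _ g [].
move=> /existsNP[x /not_implyP[Ex xyk]].
have Ek : forall x, E x -> agree F x y k'.
  by apply: contrapT => /(@asboolT _)/kmin; rewrite ltnn.
have rk : radius k' <= diam E.
  exact: le_trans (rho_ge_radius xyk) (rho_le_diam Ex Ey).
(* k' = 0 would force diameter at least 1, against [Esmall]; window n + 1 is F_n. *)
case: k' => [|n] in kmin xyk Ek rk *.
  move: (le_lt_trans rk Esmall); rewrite /= fset_set0 cardfs0 expr0 invr1.
  by rewrite ltNge invf_le1 ?exprn_gt0 // exprn_ege1 // ler1n.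
exists n; split.
- rewrite leqNgt; apply/negP => nn0; move: (le_lt_trans rk Esmall); rewrite ltNge.
  by rewrite (@radius_homo n.+1 n0.+1) // ltnS ltnW.
- exact: Ek.
- have /= <- := radius_powR s n.+1; rewrite -[leLHS]addr0 lerD ?(ltW t0) //.
  by apply: ge0_ler_powR; rewrite ?nnegrE ?radius_ge0 ?diam_ge0.
Qed.

Lemma hausdorff_content_ge0 s r X : (0 <= @hausdorff_content R G A F s r X)%E.
Proof.
apply: le_ereal_inf_tmp => _ [C _ <-]; apply: esum_ge0 => E _.
by rewrite lee_fin powR_ge0.
Qed.

Lemma hausdorff_content_nonincreasing s X :
  {homo (fun r => @hausdorff_content R G A F s r X) : r r' / r <= r' >-> (r' <= r)%E}.
Proof.
move=> r r' rr'; apply: ereal_inf_le_tmp => _ [C [cC XC Cr] <-].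
by exists C => //; split => // E /Cr /le_trans; apply.
Qed.

(** The contents are nonnegative and grow as the scale shrinks, so their limit is their supremum. *)
Lemma hausdorff_measure_eq0P s X :
  hausdorff_measure F s X = 0%E :> \bar R <->
  forall r, 0 < r -> @hausdorff_content R G A F s r X = 0%E.
Proof.
split=> [mu0 r r0|c0]; last first.
  apply/cvg_lim => //; apply: cvg_near_cst; near=> r; apply: c0; near: r.
  exact: nbhs_right_gt.
apply/eqP; rewrite eq_le hausdorff_content_ge0 andbT.
have /cvg_lim : hausdorff_content F s r X @[r --> (0:R)^'+] -->
    ereal_sup ((fun r => hausdorff_content F s r X) @` [set` `]0 : R, +oo[%R]).
  apply: nonincreasing_at_right_cvge => // a b _ _; exact: hausdorff_content_nonincreasing.
rewrite -/(hausdorff_measure F s X) mu0 => -> //; apply: ereal_sup_ubound.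
by exists r => //=; rewrite in_itv /= r0.
Unshelve. all: by end_near. Qed.

(** Each nonempty member of a countable cover with small sum is enclosed in a cylinder, at the cost
    of a tolerance eta / 2 * 2^-(k + 1) for the member numbered k. Cylinders are open, so finitely
    many suffice. *)
Lemma fine_covers_of_null (s : R) (X : set (fullshift G A)) : 0 <= s -> X !=set0 -> closed X ->
  hausdorff_measure F s X = 0%E -> fine_covers F X (2 `^ (- s) : R).
Proof.
move=> s0 X0 clX /hausdorff_measure_eq0P mu0 n0 eta eta0.
(* Half the radius turns the weak bound on diameters in [eps_cover] into the strict one needed for
   enclosing. *)
have r0 : 0 < (2 ^- #|` W n0| / 2 : R) by rewrite divr_gt0 // invr_gt0 exprn_gt0.
have eta2 : 0 < eta / 2 by rewrite divr_gt0.
have /ereal_inf_lt[_ [C [cC XC Cr] <-] sumC] :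
  (@hausdorff_content R G A F s (2 ^- #|` W n0| / 2) X < (eta / 2)%:E)%E.
  by rewrite mu0 // lte_fin.
have /countable_injP[f finj] := cC.
have /choice[n /choice[y nyP]] : forall E, exists n y, C E -> E !=set0 ->
    [/\ (n0 <= n)%N, E `<=` cylinder F y n &
        (2 `^ (- s)) ^+ #|` W n| <= diam E `^ s + eta / 2 * 2 ^- (f E).+1].
  move=> E; have [x0 _] := X0.
  have [[CE E0]|h] := pselect (C E /\ E !=set0); last first.
    by exists 0%N, x0 => CE E0; case: h.
  have tE : 0 < eta / 2 * 2 ^- (f E).+1 by rewrite mulr_gt0 // invr_gt0 exprn_gt0.
  have dE : diam E < 2 ^- #|` W n0|.
    by apply: le_lt_trans (Cr _ CE) _; move: r0; lra.
  by have [z [k h]] := enclosing_cylinder s0 tE E0 dE; exists k, z.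
pose D := [set E | C E /\ E !=set0].
have [||D' D'D XD'] := @closed_finite_subcover G A X _ D
    (fun E => cylinder F (y E) (n E)) X0 clX.
- by move=> E _; exact: (open_cylinder FB).
- move=> x Xx; have [E CE Ex] := XC x Xx; have E0 : E !=set0 by exists x.
  by exists E; [|have [_ + _] := nyP E CE E0; exact].
have D'P E : E \in D' -> C E /\ E !=set0 by move=> /D'D; rewrite inE.
exists D', (fun E => n (val E)), (fun E => y (val E)); split.
- by move=> E; have [CE E0] := D'P _ (valP E); have [] := nyP _ CE E0.
- rewrite /family_weight -(big_seq_fsetE _ D' xpredT (fun E => (2 `^ (- s)) ^+ #|` W (n E)|)).
  apply: (@le_trans _ _ (\sum_(E <- D') (diam E `^ s + eta / 2 * 2 ^- (f E).+1))).
    rewrite big_seq [leRHS]big_seq; apply: ler_sum => E /D'P[CE E0].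
    by have [] := nyP _ CE E0.
  rewrite big_split /= -mulr_sumr.
  have h1 : \sum_(E <- D') diam E `^ s <= eta / 2.
    rewrite -lee_fin; apply: le_trans (ltW sumC).
    apply: esum_ge; exists [set` D'].
      by split; [exact: finite_fset|move=> E /= /D'P[]].
    by rewrite fsbig_finite // set_fsetK sumEFin.
  have h2 : \sum_(E <- D') 2 ^- (f E).+1 <= 1 :> R.
    apply: sum_half_pow_uniq; first exact: fset_uniq.
    by move=> E E' /D'P[CE _] /D'P[CE' _]; apply: finj; rewrite inE.
  have : eta / 2 * \sum_(E <- D') 2 ^- (f E).+1 <= eta / 2 * 1 by rewrite ler_pM2l.
  lra.
- move=> x Xx; have [E /= ED' xE] := XD' x Xx.
  by exists [` ED']%fset.
Qed.

End Hausdorff.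

(** * Finite images, minima and binary logarithms *)

Lemma finite_image_finset (T : finType) (U : choiceType) (P : {set T}) (f : T -> U) :
  finite_set (f @` [set` P]).
Proof. by apply: finite_image; exact: finite_finset. Qed.

Lemma card_image_finset (T : finType) (U : choiceType) (P : {set T}) (f : T -> U) :
  (#|` fset_set (f @` [set` P])| <= #|P|)%N.
Proof.
have sub : (fset_set (f @` [set` P]) `<=` seq_fset tt (map f (enum P)))%fset.
  apply/fsubsetP => y; rewrite in_fset_set; last exact: finite_image_finset.
  by move=> /set_mem[x Px <-]; rewrite seq_fsetE map_f // mem_enum.
apply: leq_trans (fsubset_leq_card sub) _.
by rewrite size_seq_fset (leq_trans (size_undup _)) // size_map -cardE.
Qed.

Lemma leastP (P : set nat) n : P n -> P (least P) /\ forall m, P m -> (least P <= m)%N.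
Proof.
move=> Pn; suff [k kP] : [set n | P n /\ forall m, P m -> (n <= m)%N] !=set0.
  exact: xgetI kP.
have exP : exists n, `[< P n >] by exists n; apply/asboolP.
exists (ex_minn exP); case: ex_minnP => k /asboolP Pk kmin; split=> // m Pm.
by apply: kmin; apply/asboolP.
Qed.

Section Log2.
Variable R : realType.

Lemma ln2_gt0 : 0 < ln 2 :> R.
Proof. by rewrite ln_gt0 // ltr1n. Qed.

Lemma log2_le (x a : R) : 0 < x -> (log2 x <= a) = (x <= 2 `^ a).
Proof.
move=> x0; rewrite /log2 ler_pdivrMr ?ln2_gt0 // -ln_powR ler_ln // posrE.
exact: powR_gt0.
Qed.

Lemma log2_ge0 (n : nat) : 0 <= log2 n%:R :> R.
Proof.
rewrite /log2 divr_ge0 ?(ltW ln2_gt0) //; case: n => [|n]; first by rewrite ln0.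
by rewrite ln_ge0 // ler1n.
Qed.

Lemma log2_homo : {homo (fun n : nat => log2 n%:R : R) : m n / (m <= n)%N >-> m <= n}.
Proof.
(* [ln 0] is 0, so monotonicity extends to m = 0. *)
move=> [|m] n mn; first by rewrite [leLHS]/log2 ln0 // mul0r log2_ge0.
by rewrite /log2 ler_pM2r ?invr_gt0 ?ln2_gt0 // ler_ln ?posrE ?ltr0n ?ler_nat //; lia.
Qed.

End Log2.

(** * Hausdorff dimension as the limit of pattern rates *)

Section Dimension.
Variables (R : realType) (G : nmodType) (F : nat -> set G) (e d : nat).
Hypothesis FB : box_system F e d.
Variables (A : finType) (X : set (fullshift G A)).
Local Notation W n := (fset_set (F n)).

(** The cylinders over F_n give a sum of at most 2^(r |F_n|) 2^(-s |F_n|), which is small for large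
    n. Arbitrarily large n are enough. *)
Lemma null_of_few_patterns (r s : R) : 0 <= s -> r < s ->
  (forall n0, exists2 n, (n0 <= n)%N & #|patterns F X n|%:R <= 2 `^ (r * #|` W n|%:R) :> R) ->
  hausdorff_measure F s X = 0%E :> \bar R.
Proof.
move=> s0 rs few; apply/hausdorff_measure_eq0P => eps eps0.
apply/eqP; rewrite eq_le hausdorff_content_ge0 andbT.
apply/lee_addgt0Pr => eta eta0; rewrite add0e.
(* From [n1] on the sum is below [eta]; from [n2] on the diameters are below [eps]. *)
have [|n1 n1P] := @small_pow_window R G F e d FB (2 `^ (- (s - r))) eta _ eta0.
  by rewrite powR_ge0 half_powR_lt1 // subr_gt0.
have [|n2 n2P] := @small_pow_window R G F e d FB (2^-1) eps _ eps0.
  by rewrite invr_ge0 ler0n /= invf_lt1 // ltr1n.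
have [n] := few (maxn n1 n2); rewrite geq_max => /andP[/n1P h1 /n2P h2] pn.
pose cyl (w : {ffun W n -> A}) := [set x | X x /\ pattern F n x = w].
pose C := cyl @` [set` patterns F X n].
have diamC E : C E -> diam R F E <= 2 ^- #|` W n|.
  move=> [w _ <-]; apply: diam_le; first by rewrite invr_ge0 exprn_ge0.
  move=> x y [_ xw] [_ yw]; apply: (@rho_le_radius R G F e d FB A x y n.+1) => g /= Fg.
  have gW : g \in W n by rewrite (in_window FB); apply/asboolP.
  by have := congr1 (fun f : {ffun W n -> A} => f [` gW]%fset) (etrans xw (esym yw)); rewrite !ffunE.
have finC : finite_set C by exact: finite_image_finset.
apply: le_trans (_ : (\esum_(E in C) (diam R F E `^ s)%:E <= _)%E).
  apply: ereal_inf_lbound; exists C => //; split.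
  - exact: finite_set_countable.
  - move=> x Xx; exists (cyl (pattern F n x)) => //.
    by exists (pattern F n x) => //; apply/patternsP; exists x.
  - move=> E /diamC /le_trans; apply; rewrite -exprVn ltW //.
rewrite esum_fset //; last by move=> E _; rewrite lee_fin powR_ge0.
rewrite fsbig_finite //= sumEFin lee_fin.
apply: (@le_trans _ _ (\sum_(E <- fset_set C) (2 `^ (- s)) ^+ #|` W n|)).
  rewrite big_seq [leRHS]big_seq; apply: ler_sum => E.
  rewrite in_fset_set // => /set_mem /diamC dE.
  rewrite -(@radius_powR R G F s n.+1) /=.
  apply: ge0_ler_powR => //.
    by rewrite nnegrE; exact: (diam_ge0 _ FB).
  by rewrite nnegrE invr_ge0 exprn_ge0.
rewrite big_const_seq count_predT iter_addr_0 -[leLHS]mulr_natl.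
apply: (@le_trans _ _ (2 `^ (r * #|` W n|%:R) * (2 `^ (- s)) ^+ #|` W n|)).
  rewrite ler_wpM2r ?exprn_ge0 ?powR_ge0 //; apply: le_trans pn.
  by rewrite ler_nat; exact: card_image_finset.
apply: le_trans (ltW h1).
rewrite powRrM powR_mulrn ?powR_ge0 // -exprMn -powRD ?opprB //.
by apply/implyP => _; rewrite pnatr_eq0.
Qed.

Hypothesis subX : subshift X.

Lemma card_patterns_gt0 n : (0 < #|patterns F X n|)%N.
Proof.
have [[x Xx] _ _] := subX; apply/card_gt0P; exists (pattern F n x).
by apply/patternsP; exists x.
Qed.

Lemma card_patterns_upper n : (#|patterns F X n| <= #|A| ^ #|` W n|)%N.
Proof. by apply: leq_trans (max_card _) _; rewrite card_ffun cardfE. Qed.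

Definition pattern_rate n : R := log2 #|patterns F X n|%:R / #|` W n|%:R.

Lemma window_gt0 n : 0 < #|` W n|%:R :> R.
Proof. by rewrite ltr0n (card_window_gt0 FB). Qed.

Lemma pattern_rate_le n (r : R) :
  (pattern_rate n <= r) = (#|patterns F X n|%:R <= 2 `^ (r * #|` W n|%:R)).
Proof.
by rewrite /pattern_rate ler_pdivrMr ?window_gt0 // log2_le // ltr0n card_patterns_gt0.
Qed.

Lemma pattern_rate_ge0 n : 0 <= pattern_rate n.
Proof. by rewrite divr_ge0 ?log2_ge0. Qed.

Lemma pattern_rate_eventually_le (s delta : R) : 0 <= s -> 0 < delta ->
  hausdorff_measure F s X = 0%E :> \bar R ->
  exists n0, forall n, (n0 <= n)%N -> pattern_rate n <= s + delta.
Proof.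
move=> s0 delta0 mu0; have [X0 clX shX] := subX.
have cov := fine_covers_of_null FB s0 X0 clX mu0.
have q1 : 2 `^ (- s) <= 1 :> R.
  by rewrite -[leRHS](powRr0 2) ler_powR ?ler1n // oppr_le0.
(* With 1 + eps = 2^delta the growth factor (1 + eps)^|F_n| becomes 2^(delta |F_n|). *)
have eps0 : 0 < 2 `^ delta - 1 :> R.
  by rewrite subr_gt0 -invf_lt1 ?powR_gt0 // -powRN half_powR_lt1.
have [n0 n0P] := card_patterns_le FB (powR_gt0 _ (ltr0Sn R 1)) q1 eps0 shX cov.
exists n0 => n /n0P; rewrite pattern_rate_le subrKC mulrDl powRD; last first.
  by apply/implyP => _; rewrite pnatr_eq0.
rewrite !powRrM !powR_mulrn ?powR_ge0 // powRN exprVn ler_pdivrMr ?exprn_gt0 ?powR_gt0 //.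
by rewrite mulrC.
Qed.

(** Null exponents just above [D] bound the rates from above. Rates at most D - eps infinitely often
    would make D - eps / 2 a null exponent, below the infimum. *)
Lemma hausdorff_dim_rate : exists2 D : R,
  hausdorff_dim R F X = D%:E & pattern_rate @ \oo --> D.
Proof.
pose S := [set s : R | 0 <= s /\ hausdorff_measure F s X = 0%E].
have dimE : hausdorff_dim R F X = ereal_inf (EFin @` S) by [].
(* There are at most |A|^|F_n| patterns, so every exponent above log2 |A| is null and the dimension
   is finite. *)
pose L : R := log2 #|A|%:R.
have SL : S (L + 1).
  have L0 : 0 <= L by exact: log2_ge0.
  split; first lra.
  apply: (@null_of_few_patterns L); [lra|lra|move=> n0; exists n0 => //].
  have A0 : (0 < #|A|)%N.
    by have [[x _] _ _] := subX; apply/card_gt0P; exists (x 0).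
  rewrite powRrM powR_mulrn ?powR_ge0 //.
  have AL : #|A|%:R <= 2 `^ L :> R by rewrite -log2_le // ltr0n.
  apply: (@le_trans _ _ (#|A|%:R ^+ #|` W n0|)).
    by rewrite -natrX ler_nat card_patterns_upper.
  by apply: lerXn2r; rewrite ?nnegrE ?powR_ge0.
have dim_ge0 : (0 <= hausdorff_dim R F X)%E.
  by rewrite dimE; apply: le_ereal_inf_tmp => _ [s [s0 _] <-]; rewrite lee_fin.
have dim_fin : hausdorff_dim R F X \is a fin_num.
  rewrite ge0_fin_numE //; apply: le_lt_trans (ltry (L + 1)).
  by rewrite dimE; apply: ereal_inf_lbound; exists (L + 1).
pose D := fine (hausdorff_dim R F X).
have DE : hausdorff_dim R F X = D%:E by rewrite fineK.
have D_le s : S s -> D <= s.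
  by move=> Ss; rewrite -lee_fin -DE dimE; apply: ereal_inf_lbound; exists s.
exists D => //; apply/cvgrPdist_le => eps eps0.
have eps2 : 0 < eps / 2 by rewrite divr_gt0.
have [n1 n1P] : exists n0, forall n, (n0 <= n)%N -> pattern_rate n <= D + eps.
  have : (ereal_inf (EFin @` S) < (D + eps / 2)%:E)%E.
    by rewrite -dimE DE lte_fin ltrDl.
  move=> /ereal_inf_lt[_ [s [s0 mu0] <-]]; rewrite lte_fin => sD.
  have [n0 n0P] := pattern_rate_eventually_le s0 eps2 mu0.
  by exists n0 => n /n0P /le_trans; apply; lra.
have [n2 n2P] : exists n0, forall n, (n0 <= n)%N -> D - eps <= pattern_rate n.
  apply: contrapT => h.
  have few n0 : exists2 n, (n0 <= n)%N & pattern_rate n <= D - eps.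
    apply: contrapT => h0; apply: h; exists n0 => n n0n.
    by rewrite leNgt; apply/negP => h1; apply: h0; exists n => //; exact: ltW.
  (* Rates are nonnegative, so D - eps >= 0 and D - eps / 2 is an admissible exponent. *)
  have [n _ rn] := few 0%N; have := pattern_rate_ge0 n => r0.
  have : S (D - eps / 2).
    split; first lra.
    apply: (@null_of_few_patterns (D - eps)); [lra|lra|move=> n0].
    by have [m ? ?] := few n0; exists m => //; rewrite -pattern_rate_le.
  move=> /D_le; lra.
exists (maxn n1 n2) => // n /=; rewrite geq_max => /andP[/n1P h1 /n2P h2].
by rewrite ler_distlC; apply/andP; split; lra.
Qed.

End Dimension.

(** * Entropy of open covers *)

Section Entropy.
Variables (R : realType) (G : nmodType) (F : nat -> set G) (e d : nat).
Hypothesis FB : box_system F e d.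
Variables (A : finType) (X : set (fullshift G A)).
Hypothesis subX : subshift X.
Local Notation W n := (fset_set (F n)).

Lemma pattern_eqP n (x y : fullshift G A) :
  pattern F n x = pattern F n y <-> forall g, F n g -> x g = y g.
Proof.
split=> [xy g Fg|xy].
  have gW : g \in W n by rewrite (in_window FB); apply/asboolP.
  by have := congr1 (fun f : {ffun W n -> A} => f [` gW]%fset) xy; rewrite !ffunE.
apply/ffunP => g; rewrite !ffunE; apply: xy.
by have := valP g; rewrite (in_window FB) => /asboolP.
Qed.

(** Finitely many cylinders, each inside a member of the cover, cover [X]. With [k] their largest
    size, a cylinder of size [k] around a point of one of them stays inside it. *)
Lemma lebesgue_number U : open_cover X U -> exists k, forall x, X x ->
  exists2 V, U V & cylinder F x k `&` X `<=` V.
Proof.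
move=> [Uo XU]; have [X0 clX _] := subX.
have [x0 Xx0] := X0.
have /choice[n nP] : forall x, exists n, X x -> exists2 V, U V & cylinder F x n `&` X `<=` V.
  move=> x; have [Xx|nXx] := pselect (X x); last by exists 0%N.
  have [V UV Vx] := XU x Xx; have [V' oV' VE] := Uo V UV.
  have V'x : V' x by move: Vx; rewrite VE => -[].
  have [n nV'] := open_cylinder_sub FB oV' V'x.
  by exists n => _; exists V => //; rewrite VE => z [/nV' ? ?].
have [||D DX XD] := @closed_finite_subcover G A X _ X (fun x => cylinder F x (n x)) X0 clX.
- by move=> x _; exact: (open_cylinder FB).
- by move=> x Xx; exists x.
exists (\max_(x <- D) n x)%N => x Xx; have [z /= zD zx] := XD x Xx.
have [V UV zV] := nP z (set_mem (DX z zD)).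
exists V => // y [xy Xy]; apply: zV; split=> // g Fg.
rewrite -zx // xy //; apply: (box_homo FB) Fg.
exact: (@leq_bigmax_seq _ _ _ n).
Qed.

(** For g in F_n the shift of [x] by g is determined on F_k by the values of [x] on F_(n+k). *)
Lemma lebesgue_refine U k n :
  (forall x, X x -> exists2 V, U V & cylinder F x k `&` X `<=` V) ->
  forall x, X x ->
    exists2 V, cover_refine X U (F n) V & cylinder F x (n + k) `&` X `<=` V.
Proof.
have [_ _ shX] := subX; move=> Uk x Xx.
have /choice[u uP] : forall g, exists V, U V /\ cylinder F (shift_act g x) k `&` X `<=` V.
  by move=> g; have [V ? ?] := Uk _ (shX g x Xx); exists V.
exists ((\bigcap_(g in F n) (shift_act g @^-1` u g)) `&` X).
  by exists u => // g _; have [] := uP g.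
move=> z [xz Xz]; split => // g Fg; have [_] := uP g; apply; split; last exact: shX.
by move=> h Fh; apply: xz; exact: (box_add FB).
Qed.

(** One member per pattern forms a finite subcover. Hence [least] is a true minimum and not its
    default value, and some subcover attains it. *)
Lemma cover_number_le U m : (forall x, X x -> exists2 V, U V & cylinder F x m `&` X `<=` V) ->
  (cover_number X U <= #|patterns F X m|)%N /\
  exists V, [/\ V `<=` U, X `<=` \bigcup_(V' in V) V' & (V #= `I_(cover_number X U))%card].
Proof.
move=> Um; have [[x0 Xx0] _ _] := subX.
have /choice[V VP] : forall w : {ffun W m -> A}, exists V, w \in patterns F X m ->
    U V /\ forall x, X x -> pattern F m x = w -> V x.
  move=> w; have [/patternsP[x Xx xw]|_] := boolP (w \in patterns F X m); last by exists set0.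
  have [V UV xV] := Um x Xx; exists V => _; split=> // y Xy yw; apply: xV; split=> //.
  by apply/pattern_eqP; rewrite yw xw.
pose C := V @` [set` patterns F X m].
have finC : finite_set C by exact: finite_image_finset.
have /finite_setP[c Cc] := finC.
have PC : [set n | exists V', [/\ V' `<=` U, X `<=` \bigcup_(W' in V') W' & (V' #= `I_n)%card]] c.
  exists C; split => //; first by move=> _ [w /VP[UV _] <-].
  move=> x Xx; have wx : pattern F m x \in patterns F X m by apply/patternsP; exists x.
  exists (V (pattern F m x)); first by exists (pattern F m x).
  by have [_] := VP _ wx; apply.
have [? minc] := leastP PC; split=> //.
apply: leq_trans (minc _ PC) _; rewrite -(card_fset_set Cc); exact: card_image_finset.
Qed.

Definition origin_cover : set (set (fullshift G A)) :=
  [set [set x | X x /\ x 0 = a] | a in [set: A]].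

Lemma origin_coverP : open_cover X origin_cover.
Proof.
split; last by move=> x Xx; exists [set y | X y /\ y 0 = x 0] => //; exists (x 0).
move=> _ [a _ <-]; exists [set x : fullshift G A | x 0 = a]; last first.
  by apply/seteqP; split=> x [].
rewrite -[X in open X]/((fun x : fullshift G A => x 0) @^-1` [set a]).
apply: open_comp; last exact: discrete_open.
by move=> x _; exact: (@proj_continuous G (fun=> discrete_topology A) 0 x).
Qed.

(** All points in a member of the refined origin cover have the same pattern on F_n, so a subcover
    needs a separate member for every pattern. *)
Lemma cover_number_origin n :
  cover_number X (cover_refine X origin_cover (F n)) = #|patterns F X n|.
Proof.
have org x : X x -> exists2 V, origin_cover V & cylinder F x 0 `&` X `<=` V.
  move=> Xx; exists [set y | X y /\ y 0 = x 0]; first by exists (x 0).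
  by move=> y [xy Xy]; split=> //; apply: xy; exact: (box_zero FB).
have /cover_number_le := lebesgue_refine n org; rewrite addn0.
set c := cover_number _ _ => -[cle [V [VU XV Vc]]].
apply/eqP; rewrite eqn_leq cle /=.
have finV : finite_set V by apply/finite_setP; exists c.
have /choice[f fP] : forall w : {ffun W n -> A}, exists V', w \in patterns F X n ->
    V V' /\ exists2 x, V' x & pattern F n x = w.
  move=> w; have [/patternsP[x Xx xw]|_] := boolP (w \in patterns F X n); last by exists set0.
  by have [V' VV' V'x] := XV x Xx; exists V' => _; split=> //; exists x.
have f_inj : {in patterns F X n &, injective f}.
  move=> w w' /fP[Vw [x fx xw]] /fP[_ [y fy yw]] eqf.
  have [u uP fE] := VU _ Vw.
  rewrite -xw -yw; apply/pattern_eqP => g Fg; have [a _ ua] := uP g Fg.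
  move: fx fy; rewrite -eqf fE => -[/(_ g Fg) /= + _] [/(_ g Fg) /= + _].
  by rewrite -ua /= /shift_act addr0 => -[_ ->] [_ ->].
rewrite -(card_fset_set Vc) cardE -(size_map f).
apply: uniq_leq_size; first by rewrite map_inj_in_uniq ?enum_uniq // => w w';
  rewrite !mem_enum; exact: f_inj.
move=> V' /mapP[w]; rewrite mem_enum => /fP[VV' _] ->.
by rewrite in_fset_set // inE.
Qed.

(** The refinement over F_n needs at most as many members as there are patterns on F_(n+k), and
    |F_(n+k)| / |F_n| tends to 1. *)
Lemma cover_entropy_le (D : R) U : 0 <= D -> pattern_rate R F X @ \oo --> D ->
  open_cover X U -> (cover_entropy R F X U <= D%:E)%E.
Proof.
move=> D0 rateD /lebesgue_number[k Uk].
rewrite /cover_entropy; set b := fun n => _.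
(* [limn] is the junk value 0 along a divergent sequence. *)
have [cb|db] := pselect (cvgn b); last by rewrite dvgP // lee_fin.
apply/lee_addgt0Pr => eps eps0; apply: lime_le => //.
(* As dl <= 1, (D + dl)(1 + dl) <= D + dl (D + 2) <= D + eps / 2. *)
pose dl := Num.min 1 (eps / (D + 2) / 2).
have dl0 : 0 < dl by rewrite lt_min ltr01 !divr_gt0 //; lra.
have dl1 : dl <= 1 by rewrite ge_min lexx.
have dlD : dl * (D + 2) <= eps / 2.
  rewrite -ler_pdivlMr; last lra.
  by rewrite /dl ge_min mulrAC lexx orbT.
have [n0 n0P] := window_ratio FB k dl0.
have [n1 _ n1P] : \forall n \near \oo, pattern_rate R F X n <= D + dl.
  by apply: (cvgr_le _ rateD); lra.
exists (maxn n0 n1) => // n /=; rewrite geq_max => /andP[/n0P h0 n1n].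
have {n1P} h1 : pattern_rate R F X (n + k) <= D + dl.
  by apply: n1P => /=; rewrite (leq_trans n1n) ?leq_addr.
have [cn _] := cover_number_le (lebesgue_refine n Uk).
rewrite /b -EFinD lee_fin ler_pdivrMr ?(window_gt0 R FB) //.
apply: le_trans (log2_homo R cn) _.
have Wk := window_gt0 R FB (n + k); have Wn := window_gt0 R FB n.
move: h1; rewrite /pattern_rate ler_pdivrMr // => /le_trans; apply.
have : (D + dl) * #|` W (n + k)|%:R <= (D + dl) * ((1 + dl) * #|` W n|%:R).
  by rewrite ler_wpM2l //; lra.
move=> /le_trans; apply; rewrite mulrA ler_wpM2r ?(ltW Wn) //.
nra.
Qed.

Lemma entropy_eq_hausdorff_dim : entropy R F X = hausdorff_dim R F X.
Proof.
have [D -> rateD] := hausdorff_dim_rate R FB subX.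
have D0 : 0 <= D.
  have <- := cvg_lim (@Rhausdorff R) rateD.
  apply: limr_ge; first by apply/cvg_ex; exists D.
  by near=> n; exact: pattern_rate_ge0.
apply/eqP; rewrite eq_le; apply/andP; split.
  by apply: ge_ereal_sup => _ [U cU <-]; exact: cover_entropy_le.
apply: ereal_sup_ubound; exists origin_cover; first exact: origin_coverP.
apply/cvg_lim => //.
have -> : (fun n => (log2 (cover_number X (cover_refine X origin_cover (F n)))%:R /
    (window_card F n)%:R)%:E) = EFin \o pattern_rate R F X.
  by apply/funext => n /=; rewrite cover_number_origin.
exact: cvg_comp rateD _.
Unshelve. all: by end_near. Qed.

End Entropy.

(** * The boxes of N^d and Z^d *)

Section ProductBoxes.
Variables (T : choiceType) (I : finType) (s : I -> {fset T}).

Local Notation K := (\bigcup_(i <- enum I) s i)%fset.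

(** The product of the [s i], enumerated through functions into the finite type of elements of their
    union, since [T] itself may be infinite. *)
Definition pi_fset : {fset {ffun I -> T}} :=
  seq_fset tt [seq [ffun i => val (f i)] |
    f : {ffun I -> K} <- enum [pred f : {ffun I -> K} | [forall i, val (f i) \in s i]]].

Lemma pi_fsetP (g : {ffun I -> T}) : reflect (forall i, g i \in s i) (g \in pi_fset).
Proof.
rewrite seq_fsetE; apply: (iffP mapP) => [[f] + -> i|gP].
  by rewrite mem_enum ffunE => /forallP.
have gK i : g i \in K by apply/bigfcupP; exists i; rewrite ?mem_enum.
exists [ffun i => [` gK i]%fset]; last by apply/ffunP => i; rewrite !ffunE.
by rewrite mem_enum; apply/forallP => i; rewrite ffunE; exact: gP.
Qed.

Lemma card_pi_fset : #|` pi_fset| = (\prod_i #|` s i|)%N.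
Proof.
rewrite size_seq_fset undup_id; last first.
  rewrite map_inj_uniq ?enum_uniq // => f f' /ffunP ff'; apply/ffunP => i.
  by apply: val_inj; have := ff' i; rewrite !ffunE.
rewrite size_map -cardE.
rewrite (eq_card (_ : _ =i family (fun i => [pred k : K | val k \in s i]))); last first.
  by move=> f; apply/forallP/familyP.
rewrite card_family foldrE big_map big_enum /=; apply: eq_bigr => i _.
rewrite cardE -(size_map val); apply/perm_size/uniq_perm; rewrite ?fset_uniq //.
  by rewrite map_inj_uniq ?enum_uniq //; exact: val_inj.
move=> x; apply/mapP/idP => [[k]|xs]; first by rewrite mem_enum => ? ->.
have xK : x \in K by apply/bigfcupP; exists i; rewrite ?mem_enum.
by exists [` xK]%fset; rewrite ?mem_enum.
Qed.

End ProductBoxes.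

(** Every property is checked coordinatewise; the set for [box_meet] is the product of the
    one-dimensional ones. *)
Lemma coordinate_box_system (T : nmodType) (C : nat -> {fset T}) (e d : nat) :
  (0 < e)%N -> (0 < d)%N ->
  (forall n, #|` C n| = (e * n).+1) ->
  (forall n, 0 \in C n) ->
  (forall m n, (m <= n)%N -> (C m `<=` C n)%fset) ->
  (forall a, exists n, a \in C n) ->
  (forall m n a b, a \in C m -> b \in C n -> a + b \in C (m + n)%N) ->
  (forall a : T, injective (+%R a)) ->
  (forall m n (b : T), exists2 B : {fset T}, (#|` B| <= #|` C (n + m)%N|)%N &
    forall a c c', c \in C m -> c' \in C n -> a + c = b + c' -> a \in B) ->
  box_system (fun n => [set g : {ffun 'I_d -> T} | forall i, g i \in C n]) e d.
Proof.
move=> e0 d0 Ccard C0 Cmono Cex Cadd Cinj Cmeet.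
pose D n := pi_fset (fun _ : 'I_d => C n).
have DE n : [set g : {ffun 'I_d -> T} | forall i, g i \in C n] = [set` D n].
  by apply/seteqP; split => g /pi_fsetP.
have cardD n : #|` D n| = (#|` C n| ^ d)%N.
  by rewrite card_pi_fset prod_nat_const card_ord.
split=> //.
- by move=> n; rewrite DE; exact: finite_fset.
- by move=> n; rewrite DE set_fsetK cardD Ccard.
- by move=> n i; rewrite ffunE.
- by move=> m n mn g gm i; exact: (fsubsetP (Cmono _ _ mn)).
- move=> g; have /choice[n nP] : forall i, exists n, g i \in C n by move=> i; exact: Cex.
  exists (\max_i n i)%N => i; apply: fsubsetP (nP i); apply: Cmono; exact: leq_bigmax.
- by move=> m n f g fm gn i; rewrite ffunE; exact: Cadd.
- by move=> g f f' /ffunP ff'; apply/ffunP => i; have := ff' i; rewrite !ffunE => /Cinj.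
- move=> m n q; have /choice[B BP] : forall i, exists B : {fset T},
      (#|` B| <= #|` C (n + m)%N|)%N /\
      forall a c c', c \in C m -> c' \in C n -> a + c = q i + c' -> a \in B.
    by move=> i; have [B ? ?] := Cmeet m n (q i); exists B.
  exists (pi_fset B).
    rewrite DE set_fsetK !card_pi_fset.
    by apply: leq_prod => i _; exact: (BP i).1.
  move=> p f f' fm f'n /ffunP pf; apply/pi_fsetP => i.
  by apply: ((BP i).2 _ (f i) (f' i)) => //; have := pf i; rewrite !ffunE.
Qed.

Lemma natbox_system d : (0 < d)%N -> box_system (@natbox d) 1 d.
Proof.
move=> d0; pose C n : {fset nat} := seq_fset tt (iota 0 n.+1).
have CE n k : (k \in C n) = (k <= n)%N by rewrite seq_fsetE mem_iota.
have -> : @natbox d = fun n => [set g : {ffun 'I_d -> nat} | forall i, g i \in C n].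
  by apply/funext => n; apply/seteqP; split=> g gn i; have := gn i; rewrite CE.
have cardC k l : #|` seq_fset tt (iota k l)| = l.
  by rewrite size_seq_fset undup_id ?iota_uniq // size_iota.
apply: coordinate_box_system => //.
- by move=> n; rewrite cardC mul1n.
- by move=> n; rewrite CE.
- by move=> m n mn; apply/fsubsetP => k; rewrite !CE => /leq_trans; apply.
- by move=> k; exists k; rewrite CE.
- by move=> m n a b; rewrite !CE; exact: leq_add.
- by move=> a; exact: addnI.
(* b - m <= a <= b + n. When b < m the truncated difference is 0 and the interval still reaches
   beyond b + n. *)
- move=> m n b; exists (seq_fset tt (iota (b - m) (n + m).+1)); first by rewrite !cardC.
  move=> a c c'; rewrite !CE seq_fsetE mem_iota => cm cn eqac.
  have {}eqac : (a + c)%N = (b + c')%N by [].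
  lia.
Qed.

Lemma intbox_system d : (0 < d)%N -> box_system (@intbox d) 2 d.
Proof.
move=> d0; pose S (b : int) n : seq int := [seq b + (k%:Z - n%:Z) | k <- iota 0 (2 * n).+1].
have SE (b : int) n (z : int) : (z \in S b n) = (b - n%:Z <= z <= b + n%:Z).
  apply/mapP/idP => [[k]|zn]; first by rewrite mem_iota => ? ->; lia.
  by exists (absz (z - b + n%:Z)); [rewrite mem_iota; lia|lia].
pose C n : {fset int} := seq_fset tt (S 0 n).
have CE n (z : int) : (z \in C n) = (- n%:Z <= z <= n%:Z) by rewrite seq_fsetE SE sub0r add0r.
have -> : @intbox d = fun n => [set g : {ffun 'I_d -> int} | forall i, g i \in C n].
  by apply/funext => n; apply/seteqP; split=> g gn i; have := gn i; rewrite CE.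
have cardS b n : #|` seq_fset tt (S b n)| = (2 * n).+1.
  rewrite size_seq_fset undup_id ?size_map ?size_iota // map_inj_uniq ?iota_uniq //.
  by move=> k l; lia.
apply: coordinate_box_system => //.
- by move=> n; rewrite cardS.
- by move=> n; rewrite CE; lia.
- by move=> m n mn; apply/fsubsetP => z; rewrite !CE; lia.
- by move=> z; exists (absz z); rewrite CE; lia.
- by move=> m n a b; rewrite !CE; lia.
- move=> m n b; exists (seq_fset tt (S b (n + m)%N)); first by rewrite !cardS.
  by move=> a c c'; rewrite !CE seq_fsetE SE; lia.
Qed.

Theorem theorem4p2 (R : realType) (d : nat) (hd : (0 < d)%N)
    (A : finType) (hA : (0 < #|A|)%N) :
  (forall X : set (fullshift (natlat d) A),
     subshift X -> entropy R (@natbox d) X = hausdorff_dim R (@natbox d) X) /\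
  (forall X : set (fullshift (intlat d) A),
     subshift X -> entropy R (@intbox d) X = hausdorff_dim R (@intbox d) X).
Proof.
split=> X subX; first exact: (entropy_eq_hausdorff_dim R (natbox_system hd) subX).
exact: (entropy_eq_hausdorff_dim R (intbox_system hd) subX).
Qed.
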